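(* Any random field is restored by its $f$-distribution. That is, if $P$ and $P'$ are (positive) random fields whose $f$-distributions $Q^f_P=\{Q_V^z\}$ and $Q^f_{P'}=\{Q_V'^{z}\}$ coincide, i.e. $Q_V^z(x)=Q_V'^{z}(x)$ for all $V\in W$, $z\in\widehat{X_V^f}$, $x\in X^V$, then $P=P'$.
   Context: $X\subset\mathbb{R}$ is a finite set with $1<|X|<\infty$, and $d\ge 1$. For $S\subset\mathbb{Z}^d$, $W(S)$ is the set of all finite subsets of $S$, and $W=W(\mathbb{Z}^d)$. $X^S$ is the set of configurations on $S$ (functions $S\to X$), $X^{\emptyset}$ consists of the empty configuration only. For disjoint $S,T$ and $x\in X^S$, $y\in X^T$, $xy\in X^{S\cup T}$ is the concatenation. For $V\in W$, $\widehat{X_V^f}=\bigcup_{\emptyset\neq S\in W(\mathbb{Z}^d\setminus V)}X^S$ is the set of configurations with nonempty finite support outside $V$. A random field is a probability measure $P$ on $X^{\mathbb{Z}^d}$ with the $\sigma$-algebra generated by cylinder sets; $P_V$ denotes its marginal on $X^V$, $V\in W$. All random fields are assumed positive: $P_V(x)>0$ for all $V\in W$, $x\in X^V$. The $f$-distribution (finite-conditional distribution) of $P$ is the system $Q_P^f=\{Q_V^z, z\in\widehat{X_V^f}, V\in W\}$, where for $z\in X^S$, $\emptyset\ne S\in W(\mathbb{Z}^d\setminus V)$, $Q_V^z(x)=P_{V\cup S}(xz)/P_S(z)$, $x\in X^V$. *)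

(* Defs.v *)
From HB Require Import structures.
From mathcomp Require Import all_boot all_order all_algebra finmap.
From mathcomp Require Import all_classical all_reals all_analysis.

Set Implicit Arguments.
Unset Strict Implicit.
Unset Printing Implicit Defensive.

Import Order.TTheory GRing.Theory Num.Theory.
Local Open Scope classical_set_scope.
Local Open Scope ring_scope.

Notation site d := 'rV[int]_d.

Section RandomFields.
Context (d : nat) (R : realType) (X : {fset R}) (hX : (1 < #|` X|)%N).

(* The alphabet as a finite type. The proof hX is a parameter only because
   measurable types have to be pointed, i.e. nonempty. *)
Definition spin of (1 < #|` X|)%N : Type := X.
HB.instance Definition _ h := Finite.on (spin h).

Lemma spin_inh : inhabited (spin hX).
Proof.
have : X != fset0 by rewrite -cardfs_gt0 ltnW.
by case/fset0Pn => x xX; exists; exact: [` xX]%fset.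
Qed.

Definition spin_point : spin hX :=
  projT1 (cid (let: inhabits x := spin_inh in ex_intro (fun=> True) x I)).
HB.instance Definition _ := isPointed.Build (spin hX) spin_point.

Definition conf (S : {fset site d}) := {ffun S -> spin hX}.

Definition restr (S : {fset site d}) (w : site d -> spin hX) : conf S :=
  [ffun t : S => w (val t)].

Lemma in_right (V S : {fset site d}) (t : (V `|` S)%fset) :
  (val t \in V) = false -> val t \in S.
Proof. by have := fsvalP t; rewrite in_fsetU => /orP[->|]. Qed.

(* The concatenation xy; it is only meaningful when V and S are disjoint
   (on a common site it would take the value of x). *)
Definition concat (V S : {fset site d}) (x : conf V) (y : conf S) :
    conf (V `|` S)%fset :=
  [ffun t : (V `|` S)%fset =>
    match boolP (val t \in V) with
    | AltTrue tV => x [` tV]%fset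
    | AltFalse tV => y [` in_right (negbTE tV)]%fset
    end].

Definition cylinder : set (set (site d -> spin hX)) :=
  [set A | exists (S : {fset site d}) (B : set (conf S)), A = @restr S @^-1` B].

Definition field_space := g_sigma_algebraType cylinder.

(* Equality of random fields must be stated on measurable sets: as a Rocq
   function, a measure also takes unspecified values on nonmeasurable ones. *)
Definition random_field := probability field_space R.

Definition marginal (P : random_field) (V : {fset site d}) (x : conf V) : R :=
  fine (P [set w | restr V w = x]).

Definition positive (P : random_field) : Prop :=
  forall (V : {fset site d}) (x : conf V), 0 < marginal P x.

Record fconf (V : {fset site d}) := FConf {
  fsupp : {fset site d};
  fsupp_neq0 : fsupp != fset0;
  fsupp_disj : [disjoint fsupp & V]%fset;
  fval :> conf fsupp }.

Definition fdistr (P : random_field) (V : {fset site d}) (z : fconf V)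
    (x : conf V) : R :=
  marginal P (concat x z) / marginal P (fval z).

End RandomFields.

(* Main.v *)
Require Import Defs.
From mathcomp Require Import all_boot all_order all_algebra finmap.
From mathcomp Require Import all_classical all_reals all_analysis.
Local Open Scope classical_set_scope.
Local Open Scope ring_scope.

Set Implicit Arguments.
Unset Strict Implicit.
Unset Printing Implicit Defensive.
Import Order.TTheory GRing.Theory Num.Theory.

(** Let V and S be disjoint nonempty finite sets of sites, x a configuration
on V and z one on S. By positivity the two conditional probabilities
Q_V^z(x) = P(xz) / P(z) and Q_S^x(z) = P(zx) / P(x) have the quotient
P(x) / P(z), in which the joint probability P(xz) = P(zx) has cancelled.
Hence the f-distribution determines all the ratios P(x) / P(z)
([fdistr_proportional]). Fixing z and summing over all the configurations x
on V, whose probabilities add up to 1, it determines 1 / P(z) itself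
([fdistr_marginal]). Such a V exists outside any S because the lattice is
infinite, which is where d >= 1 enters ([site_notin_fset]).

So P and P' have the same marginals on nonempty finite sets. The measure of a
cylinder is a finite sum of marginals ([measure_cylinder]) and every cylinder
can be based on a nonempty set ([cylinder_widen]), so P and P' agree on
cylinders. These form a pi-system generating the sigma-algebra
([setI_closed_cylinder]), and two probability measures that agree on such a
system are equal. *)

Lemma site_notin_fset (d : nat) (S : {fset site d}) :
  (0 < d)%N -> exists s : site d, s \notin S.
Proof.
(* The constant vector with entry m + 1, where m bounds the absolute value of
   one coordinate over S. *)
move=> d_gt0; pose j := Ordinal d_gt0.
pose m := \max_(t <- enum_fset S) `|t ord0 j|%N.
exists (const_mx m.+1%:Z); apply/negP => inS.
have: (`|(const_mx m.+1%:Z : site d) ord0 j|%N <= m)%N.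
  exact: (@leq_bigmax_seq _ _ xpredT (fun t : site d => `|t ord0 j|%N)).
by rewrite mxE absz_nat ltnn.
Qed.

Section RandomFields.
Context (d : nat) (R : realType) (X : {fset R}) (hX : (1 < #|` X|)%N).
Local Notation conf := (@conf d R X hX).
Local Notation restr := (@restr d R X hX).
Implicit Types (S T V : {fset site d}) (w : site d -> spin hX).
Implicit Types (P : random_field d hX).

Lemma restr_eqP S w w' : restr S w = restr S w' <-> {in S, w =1 w'}.
Proof.
split=> [/ffunP eqw t tS|eqw]; first by have := eqw [` tS]%fset; rewrite !ffunE.
by apply/ffunP => t; rewrite !ffunE eqw// fsvalP.
Qed.

Lemma restr_surj S (x : conf S) : exists w, restr S w = x.
Proof.
exists (fun t => if insub t is Some u then x u else spin_point hX).
by apply/ffunP => t; rewrite ffunE valK.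
Qed.

(** The events of S are events of any larger T. Using the image under [restr T]
as new base avoids a restriction map from configurations on T to those
on S. *)
Lemma cylinder_widen S T (B : set (conf S)) : (S `<=` T)%fset ->
  restr S @^-1` B = restr T @^-1` (restr T @` (restr S @^-1` B)).
Proof.
move=> /fsubsetP ST; apply/seteqP; split=> [w Bw|w [w' Bw' /restr_eqP eqw]].
  by exists w.
rewrite /preimage/= -(_ : restr S w' = restr S w)//.
by apply/restr_eqP => t /ST; exact: eqw.
Qed.

(** Two cylinders have a common support, the union of theirs, over which their
intersection is that of the bases. *)
Lemma setI_closed_cylinder : setI_closed (@cylinder d R X hX).
Proof.
move=> _ _ [S [B ->]] [T [C ->]]; exists (S `|` T)%fset.
rewrite (cylinder_widen _ (fsubsetUl S T)) (cylinder_widen _ (fsubsetUr S T)).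
by eexists; rewrite -preimage_setI.
Qed.

Lemma measurable_cylinder S (B : set (conf S)) :
  measurable (restr S @^-1` B : set (field_space d hX)).
Proof. by apply: sub_sigma_algebra; exists S, B. Qed.

Lemma marginalE P S (x : conf S) : (marginal P x)%:E = P (restr S @^-1` [set x]).
Proof.
by rewrite /marginal fineK//; apply: fin_num_measure; exact: (measurable_cylinder [set x]).
Qed.

(** Finite additivity: a base is a finite union of single configurations. *)
Lemma measure_cylinder P S (B : set (conf S)) :
  P (restr S @^-1` B) = (\sum_(x \in B) marginal P x)%:E.
Proof.
rewrite -fsumEFin; last exact: finite_finset.
rewrite -[in LHS](image_id B) -bigcup_imset1 preimage_bigcup.
rewrite measure_fin_bigcup; first last.
- by move=> x _; exact: measurable_cylinder.
- exact: trivIset_preimage1.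
- exact: finite_finset.
by apply: eq_fsbigr => x _; rewrite marginalE.
Qed.

Lemma sum_marginal P S : \sum_(x \in [set: conf S]) marginal P x = 1.
Proof.
by apply: EFin_inj; rewrite -measure_cylinder preimage_setT probability_setT.
Qed.

Lemma restr_concat V S (x : conf V) (z : conf S) w : [disjoint V & S]%fset ->
  restr (V `|` S)%fset w = concat x z <-> restr V w = x /\ restr S w = z.
Proof.
move=> dVS; have [wx <-] := restr_surj x; have [wz <-] := restr_surj z.
have -> : concat (restr V wx) (restr S wz) =
    restr (V `|` S)%fset (fun t => if t \in V then wx t else wz t).
  by apply/ffunP => t; rewrite !ffunE; case: {-}_ / boolP => tV;
    rewrite ffunE/= ?tV// (negbTE tV).
rewrite !restr_eqP; split=> [eqw|[eqx eqz] t].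
  split=> t tA; rewrite eqw ?in_fsetU ?tA ?orbT//.
  by rewrite (negbTE (fdisjointP_sym dVS _ tA)).
by rewrite in_fsetU; case: ifPn => [tV _|tV /= tS]; [exact: eqx | exact: eqz].
Qed.

(** Both concatenations describe the event that the field is x on V and z on S.
They are not comparable as configurations, since their supports are unions
taken in opposite orders. *)
Lemma marginal_concatC P V S (x : conf V) (z : conf S) : [disjoint V & S]%fset ->
  marginal P (concat x z) = marginal P (concat z x).
Proof.
move=> dVS; congr (fine (P _)); apply/seteqP; split=> w /=.
  move=> /(restr_concat _ _ _ dVS)[? ?].
  by apply/restr_concat; rewrite 1?fdisjoint_sym.
by rewrite restr_concat 1?fdisjoint_sym// => -[? ?]; apply/restr_concat.
Qed.

(** The equality of the ratios P(x) / P(z), cross-multiplied: conditioning V on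
z and S on x involves the same joint probability, which cancels. *)
Lemma fdistr_proportional P P' V S (x : conf V) (z : conf S) :
    positive P -> positive P' ->
    (forall V (z : fconf hX V) (x : conf V), fdistr P z x = fdistr P' z x) ->
    V != fset0 -> S != fset0 -> [disjoint V & S]%fset ->
  marginal P x * marginal P' z = marginal P' x * marginal P z.
Proof.
move=> P0 P'0 eqQ V0 S0 dVS.
have dSV : [disjoint S & V]%fset by rewrite fdisjoint_sym.
have := eqQ V (FConf S0 dSV z) x; have := eqQ S (FConf V0 dVS x) z.
rewrite /fdistr/= (marginal_concatC P _ _ dVS) (marginal_concatC P' _ _ dVS).
have := P0 _ (concat z x); have := P'0 _ (concat z x).
have := P0 _ x; have := P'0 _ x; have := P0 _ z; have := P'0 _ z.
(* Now a, a' stand for the joint probabilities of x and z under P, P', and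
   p, p', q, q' for those of x and z alone. *)
move: (marginal P (concat z x)) (marginal P' (concat z x)) => a a'.
move: (marginal P x) (marginal P' x) (marginal P z) (marginal P' z).
move=> p p' q q' /lt0r_neq0 q'0 /lt0r_neq0 q0 /lt0r_neq0 p'0 /lt0r_neq0 p0.
move=> /lt0r_neq0 a'0 /lt0r_neq0 a0 /eqP + /eqP.
rewrite (eqr_div _ _ p0 p'0) (eqr_div _ _ q0 q'0) => /eqP ex /eqP ez.
apply: (mulfI (mulf_neq0 a'0 a0)).
by rewrite mulrACA -ex ez mulrACA [a * a']mulrC.
Qed.

(** The ratios to z of all the configurations at one site s outside S are
known, and the probabilities of these configurations sum to 1. *)
Lemma fdistr_marginal P P' S (z : conf S) : (0 < d)%N ->
    positive P -> positive P' ->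
    (forall V (z : fconf hX V) (x : conf V), fdistr P z x = fdistr P' z x) ->
    S != fset0 ->
  marginal P z = marginal P' z.
Proof.
move=> d0 P0 P'0 eqQ S0; have [s sS] := site_notin_fset S d0.
have s0 : [fset s]%fset != fset0 by apply/fset0Pn; exists s; rewrite in_fset1.
have dsS : [disjoint [fset s] & S]%fset by rewrite fdisjoint1X.
rewrite -[LHS]mulr1 -[RHS]mulr1.
rewrite -{1}(sum_marginal P' [fset s]%fset) -(sum_marginal P [fset s]%fset) !mulr_fsumr.
apply: eq_fsbigr => x _; rewrite mulrC [RHS]mulrC.
by rewrite (@fdistr_proportional P P').
Qed.

End RandomFields.

Theorem theorem1 (d : nat) (hd : (1 <= d)%N) (R : realType) (X : {fset R})
    (hX : (1 < #|` X|)%N) (P P' : random_field d hX)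
    (hP : positive P) (hP' : positive P')
    (hQ : forall (V : {fset site d}) (z : fconf hX V) (x : conf hX V),
        fdistr P z x = fdistr P' z x) :
  forall A : set (field_space d hX), measurable A -> P A = P' A.
Proof.
have eq_cylinder A : @cylinder d R X hX A -> P A = P' A.
  move=> [S [B ->]]; have [s _] := site_notin_fset fset0 hd.
  (* Adjoining a site to the support makes it nonempty, so that the supports
     S = fset0 need no separate treatment. *)
  rewrite (cylinder_widen _ (fsubsetU1 s S)) !measure_cylinder.
  congr EFin; apply: eq_fsbigr => x _; apply: fdistr_marginal => //.
  by apply/fset0Pn; exists s; exact: fset1U1.
apply: (@measure_unique _ _ (field_space d hX) (@cylinder d R X hX)
  (fun=> setT) erefl (@setI_closed_cylinder d R X hX) _ _ P P') => //.
- by move=> _; exists fset0, setT; rewrite preimage_setT.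
- by rewrite bigcup_const.
- move=> _; apply: (@le_lt_trans _ _ 1%E) (ltry _).
  exact: (probability_le1 P measurableT).
Qed.
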